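(* For all positive integers $n$, the number $2^{4n}\,\mathrm d_{2n}^2\,\mathbf b_n$ is an integer, where $\mathrm d_{m}=\operatorname{lcm}(1,2,\dots,m)$ and $$ \mathbf b_n=(-1)^n\sum_{j=0}^{n}\sum_{e=1}^{3}\frac{1}{(3-e)!}\frac{\partial^{3-e}}{\partial\varepsilon^{3-e}}\Bigg(\Big(\frac n2-j+\varepsilon\Big)\Big(\frac{n!}{(1-\varepsilon)_j\,(1+\varepsilon)_{n-j}}\Big)^3\binom{n+j-\varepsilon-\frac12}{n}\binom{2n-j+\varepsilon-\frac12}{n}\Bigg)\Bigg|_{\varepsilon=0}\;\sum_{k=1}^{j}\frac{(-1)^k}{\left(k-\frac12\right)^e}. $$
   Context: The Pochhammer symbol is $(\alpha)_k=\alpha(\alpha+1)\cdots(\alpha+k-1)$ for integers $k\ge1$, and $(\alpha)_0=1$. For a non-negative integer $m$ and real $x$, $\binom{x}{m}=\frac{x(x-1)\cdots(x-m+1)}{m!}$. An empty sum is $0$, and the zeroth derivative is the function itself. Origin of $\mathbf b_n$: with Catalan's constant $G=\sum_{k=1}^\infty\frac{(-1)^{k-1}}{(2k-1)^2}$ and $$\mathbf G_n=n!\sum_{k=1}^{\infty}(-1)^k\Big(k+\frac{n-1}{2}\Big)\frac{(k-n)_n(k+n)_n}{\left(k-\frac12\right)_{n+1}^3},$$ a partial fraction decomposition of the summand with respect to $k$ gives $\mathbf G_n=\mathbf a_nG-\mathbf b_n$ with $\mathbf b_n$ given by the explicit formula in the claim (and $\mathbf a_n$ an explicit rational number); the explicit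 formula is to be taken as the definition of $\mathbf b_n$. *)

(* Defs.v *)
From HB Require Import structures.
From mathcomp Require Import all_boot all_order all_algebra.
From mathcomp Require Import all_classical all_reals all_analysis.
Set Implicit Arguments.
Unset Strict Implicit.
Unset Printing Implicit Defensive.
Import Order.TTheory GRing.Theory Num.Theory.
Import numFieldNormedType.Exports.
Local Open Scope ring_scope.

Definition lcm_upto (m : nat) : nat := (\big[lcmn/1]_(1 <= i < m.+1) i)%N.

Definition pochhammer (R : realType) (a : R) (k : nat) : R :=
  \prod_(i < k) (a + i%:R).

Definition gbinom (R : realType) (x : R) (m : nat) : R :=
  (\prod_(i < m) (x - i%:R)) / m`!%:R.

(* The real numbers b_n in the linear forms a_n G - b_n to Catalan's
   constant G; they are assembled from the Taylor coefficients at eps = 0 of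
   b_kernel n j.  For j <= n the denominator of b_kernel n j does not vanish
   when -1 < eps < 1, so the convention x / 0 = 0 plays no role there. *)
Definition b_kernel (R : realType) (n j : nat) (eps : R) : R :=
  (n%:R / 2 - j%:R + eps)
  * (n`!%:R / (pochhammer (1 - eps) j * pochhammer (1 + eps) (n - j))) ^+ 3
  * gbinom (n%:R + j%:R - eps - 1 / 2) n
  * gbinom (2 * n%:R - j%:R + eps - 1 / 2) n.

(* The ordinal j : 'I_n.+1 ranges over 0, ..., n; the subtractions n - j and
   3 - e on nat are never truncated. *)
Definition catalan_b (R : realType) (n : nat) : R :=
  (-1) ^+ n *
  \sum_(j < n.+1) \sum_(1 <= e < 4)
    (1 / (3 - e)`!%:R * derive1n (3 - e) (@b_kernel R n j) 0
     * \sum_(1 <= k < j.+1) (-1) ^+ k / (k%:R - 1 / 2) ^+ e).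

(* Main.v *)
Require Import Defs.
From mathcomp Require Import all_boot all_order all_algebra.
From mathcomp Require Import all_classical all_reals all_analysis.
From mathcomp Require Import ring lra zify.
Import Order.TTheory GRing.Theory Num.Theory.
Import numFieldNormedType.Exports.
Set Implicit Arguments.
Unset Strict Implicit.
Unset Printing Implicit Defensive.
Local Open Scope ring_scope.

(* Put s = j - e with e the formal variable epsilon.  By Leibniz' rule, b_n is
   (-1)^n times the coefficient of e^2 in
     sum_j e^3 Rt(j - e) S_j(e),
     S_j(e) = (-1)^j sum_(1 <= k <= j) (-1)^k / (k - 1/2 - e),
   where Rt(s) is the summand of G_n at 1/2 - s up to sign, so that b_n is the
   value at Rt of a linear functional L on rational functions with poles of
   order at most 3 at integers.  Since S_j + S_(j+1) = 1 / (j + 1/2 - e) and the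
   residues of a rational function add up to zero,
     L(f(s) + f(s - 1)) = f(-1/2).
   The Pfaff-Saalschuetz identity expands Rt as an alternating sum, over
   0 <= l <= n, of c_l kappa_(n,l), where
     c_l = C(n,l) C(n-1/2,l) C(n+l-1/2,l),
   and kappa_(n,l) is well poised of lower order.  Both
   kappa_(n,l) - kappa_(n-1,l) and kappa_(0,l) + kappa_(0,l-1) have the form
   f(s) + f(s - 1) with f a constant over a product of linear factors, so
   mu_(n,l) = L(kappa_(n,l)) is an explicit sum, reached from L(kappa_(0,0)) = 0
   by increasing first l and then n.  After multiplication by c_l each summand
   is, up to powers of 2, an integer times a product of two numbers of the form
   l! / (x(x+1)...(x+l)) with x a half-integer; d_(2n) clears the denominator of
   each of them by partial fractions.  This is why the square of d_(2n)
   suffices although the poles of Rt are triple. *)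

(** * Second-order Taylor coefficients at 0 *)

(** Encodes the expansion a + b x + c x^2 + o(x^2). The factor 2 makes [c] a Taylor coefficient
    rather than a second derivative, so that [jet2M] is the truncated Cauchy product. *)
Definition jet2 (R : realType) (f : R -> R) (a b c : R) : Prop :=
  exists f1 : R -> R,
    [/\ f 0 = a, f1 0 = b,
        \forall x \near (0 : R), is_derive (x : R) (1 : R) f (f1 x)
      & is_derive (0 : R) 1 f1 (2 * c)].

Section Jets.
Local Open Scope classical_set_scope.
Variable R : realType.
Implicit Types (f g : R -> R) (a b c x : R).

Lemma jet2_cst a : jet2 (fun=> a) a 0 0.
Proof.
exists (fun=> 0); split => //; first by near=> x; exact: is_derive_cst.
by rewrite mulr0; exact: is_derive_cst.
Unshelve. all: by end_near. Qed.

Lemma jet2_id : jet2 (fun x : R => x) 0 1 0.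
Proof.
exists (fun=> 1); split => //; first by near=> x; exact: is_derive_id.
by rewrite mulr0; exact: is_derive_cst.
Unshelve. all: by end_near. Qed.

Lemma jet2D f g a b c a' b' c' : jet2 f a b c -> jet2 g a' b' c' ->
  jet2 (fun x => f x + g x) (a + a') (b + b') (c + c').
Proof.
move=> [f1 [<- <- df df1]] [g1 [<- <- dg dg1]].
exists (fun x => f1 x + g1 x); split => //.
  by near=> x; apply: is_deriveD; near: x.
by rewrite mulrDr; exact: is_deriveD.
Unshelve. all: by end_near. Qed.

Lemma jet2M f g a b c a' b' c' : jet2 f a b c -> jet2 g a' b' c' ->
  jet2 (fun x => f x * g x) (a * a') (a * b' + b * a')
    (a * c' + b * b' + c * a').
Proof.
move=> [f1 [<- <- df df1]] [g1 [<- <- dg dg1]].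
exists (fun x => f x * g1 x + g x * f1 x); split => //.
- by congr (_ + _); rewrite mulrC.
- near=> x; have dfx : is_derive x 1 f (f1 x) by near: x.
  have dgx : is_derive x 1 g (g1 x) by near: x.
  exact: (is_deriveM dfx dgx).
- apply: (is_derive_eq (is_deriveD (is_deriveM (nbhs_singleton df) dg1)
    (is_deriveM (nbhs_singleton dg) df1))).
  by rewrite /GRing.scale /=; ring.
Unshelve. all: by end_near. Qed.

Lemma is_derive1_cvg f x df : is_derive x 1 f df -> f y @[y --> x] --> f x.
Proof. by move=> [/derivable1_diffP/differentiable_continuous]. Qed.

Lemma jet2V f a b c : a != 0 -> jet2 f a b c ->
  jet2 (fun x => (f x)^-1) a^-1 (- b / a ^+ 2) (b ^+ 2 / a ^+ 3 - c / a ^+ 2).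
Proof.
move=> a0 [f1 [fa fb df df1]].
have dfa := nbhs_singleton df.
have f0 : \forall x \near (0 : R), f x != 0.
  by apply: (cvgr_neq0 _ (is_derive1_cvg dfa)); rewrite fa.
exists (fun x => - ((f x)^-1 * (f x)^-1) * f1 x); split.
- by rewrite fa.
- by rewrite fa fb; field.
- near=> x; have dfx : is_derive x 1 f (f1 x) by near: x.
  have fx0 : f x != 0 by near: x.
  apply: (is_derive_eq (is_deriveV fx0 dfx)).
  by rewrite /GRing.scale /=; field.
- have f00 : f 0 != 0 by rewrite fa.
  have dV := is_deriveV f00 dfa.
  apply: (is_derive_eq (is_deriveM (is_deriveN (is_deriveM dV dV)) df1)); rewrite /GRing.scale /= fa fb.
  by rewrite fctE /= fctE fa; field.
Unshelve. all: by end_near. Qed.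

Lemma jet2_derive f a b c : jet2 f a b c ->
  [/\ derive1n 0 f 0 = a, derive1n 1 f 0 = b & derive1n 2 f 0 = 2 * c].
Proof.
move=> [f1 [fa fb df df1]]; split => //.
  by rewrite /derive1n /= derive1E; have [_ ->] := nbhs_singleton df.
rewrite /derive1n /= derive1E -(@derive_val _ _ _ _ _ _ _ df1).
apply: near_eq_derive; near=> x; rewrite derive1E.
have dfx : is_derive x 1 f (f1 x) by near: x.
by rewrite derive_val.
Unshelve. all: by end_near. Qed.

(** One-sided limits determine the value and the derivative at 0 of a differentiable function.
    Identities are later available for small positive arguments only, because the rational functions
    involved have poles at 0. *)
Lemma right_zero_derive0 f df (e : R) : 0 < e ->
  (forall x, 0 < x < e -> f x = 0) -> is_derive (0 : R) 1 f df ->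
  f 0 = 0 /\ df = 0.
Proof.
move=> e0 fz d.
have near0 : \forall x \near (0 : R)^'+, f x = 0.
  near=> x; apply: fz; apply/andP; split; near: x.
    exact: nbhs_right_gt.
  exact: nbhs_right_lt.
have f00 : f 0 = 0.
  have h := cvg_at_right_filter (is_derive1_cvg d).
  have h0 : f x @[x --> (0 : R)^'+] --> (0 : R).
    exact: (cvg_near_cst 0 near0).
  exact: (cvg_unique (@Rhausdorff R) h h0).
split => //.
have [/cvg_ex[l hl] <-] := d.
have -> : 'D_1 f 0 = l by exact: (cvg_lim (@Rhausdorff R) hl).
have hl' := cvg_dnbhs_at_right hl.
have h0 : h^-1 *: ((f \o shift 0) (h *: 1) - f 0) @[h --> (0 : R)^'+] --> (0 : R).
  apply: (cvg_near_cst 0); near=> x.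
  rewrite /= f00 subr0 addr0 (_ : x *: 1 = x) ?[_ *: 1]mulr1//.
  by rewrite (_ : f x = 0) ?scaler0//; near: x.
exact: (cvg_unique (@Rhausdorff R) hl' h0).
Unshelve. all: by end_near. Qed.

(** To the right of 0 the derivative [f1] vanishes along with [f], so [right_zero_derive0] applies
    to [f1] itself. *)
Lemma jet2_eq0 f a b c (e : R) : 0 < e -> (forall x, 0 < x < e -> f x = 0) ->
  jet2 f a b c -> c = 0.
Proof.
move=> e0 fz [f1 [fa fb df df1]].
have /nbhs_ballP[r /= r0 hr] := df.
pose e' := Num.min e r.
have f1z x : 0 < x < e' -> f1 x = 0.
  rewrite lt_min => /andP[x0 /andP[xe xr]].
  have [_ <-] : is_derive x 1 f (f1 x).
    by apply: hr; rewrite /ball /= sub0r normrN gtr0_norm.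
  rewrite (@near_eq_derive _ _ _ _ (cst 0)) ?derive_cst//.
  near=> y; apply: fz; apply/andP; split; near: y; [exact: lt_nbhsr|exact: lt_nbhsl].
have [] := @right_zero_derive0 f1 _ e' _ f1z df1; first by rewrite lt_min e0.
by move=> _ /eqP; rewrite mulf_eq0 pnatr_eq0 /= => /eqP.
Unshelve. all: by end_near. Qed.

End Jets.

(** * The coefficient of e^2, read off to the right of 0 *)

Definition regular0 (R : realType) (f : R -> R) : Prop :=
  exists a b c, jet2 f a b c.

(** Meant for functions with a removable singularity at 0, where the convention x / 0 = 0 may give
    [f] a wrong value; hence [f] is compared with [g] on (0, 1/2) only. For such e no i - e is an
    integer or a half-integer. *)
Definition coef2 (R : realType) (f : R -> R) (c : R) : Prop :=
  exists g a b, jet2 g a b c /\ forall e, 0 < e < 1 / 2 -> f e = g e.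

Section Coef2.
Variable R : realType.
Implicit Types (f g : R -> R) (a b c e : R).

Lemma regular0_cst a : regular0 (fun=> a).
Proof. by exists a, 0, 0; exact: jet2_cst. Qed.

Lemma regular0_id : regular0 (fun e : R => e).
Proof. by exists 0, 1, 0; exact: jet2_id. Qed.

Lemma regular0D f g : regular0 f -> regular0 g -> regular0 (fun e => f e + g e).
Proof.
move=> [a [b [c jf]]] [a' [b' [c' jg]]].
by do 3!eexists; exact: jet2D jf jg.
Qed.

Lemma regular0M f g : regular0 f -> regular0 g -> regular0 (fun e => f e * g e).
Proof.
move=> [a [b [c jf]]] [a' [b' [c' jg]]].
by do 3!eexists; exact: jet2M jf jg.
Qed.

Lemma regular0V f : f 0 != 0 -> regular0 f -> regular0 (fun e => (f e)^-1).
Proof.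
move=> f0 [a [b [c jf]]].
have fa : f 0 = a by case: jf => ? [].
by do 3!eexists; apply: jet2V jf; rewrite -fa.
Qed.

Lemma regular0N f : regular0 f -> regular0 (fun e => - f e).
Proof.
move=> rf; rewrite (_ : (fun e => _) = (fun e => -1 * f e)).
  by apply: regular0M rf; exact: regular0_cst.
by apply/funext => e; rewrite mulN1r.
Qed.

Lemma regular0B f g : regular0 f -> regular0 g -> regular0 (fun e => f e - g e).
Proof. by move=> rf rg; apply: regular0D rf _; exact: regular0N. Qed.

Lemma regular0_sum I (r : seq I) (P : pred I) (F : I -> R -> R) :
  (forall i, P i -> regular0 (F i)) ->
  regular0 (fun e => \sum_(i <- r | P i) F i e).
Proof.
move=> rF; elim: r => [|i r IHr].
  rewrite (_ : (fun e => _) = fun=> 0); first exact: regular0_cst.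
  by apply/funext => e; rewrite big_nil.
case Pi: (P i); last first.
  by rewrite (_ : (fun e => _) = (fun e => \sum_(i <- r | P i) F i e))//;
    apply/funext => e; rewrite big_cons Pi.
rewrite (_ : (fun e => _) = (fun e => F i e + \sum_(i <- r | P i) F i e)).
  by apply: regular0D IHr; exact: rF.
by apply/funext => e; rewrite big_cons Pi.
Qed.

Lemma regular0_prod I (r : seq I) (F : I -> R -> R) :
  (forall i, regular0 (F i)) -> regular0 (fun e => \prod_(i <- r) F i e).
Proof.
move=> rF; elim: r => [|i r IHr].
  rewrite (_ : (fun e => _) = fun=> 1); first exact: regular0_cst.
  by apply/funext => e; rewrite big_nil.
rewrite (_ : (fun e => _) = (fun e => F i e * \prod_(i <- r) F i e)).
  by apply: regular0M IHr; exact: rF.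
by apply/funext => e; rewrite big_cons.
Qed.

Lemma regular0X f n : regular0 f -> regular0 (fun e => f e ^+ n).
Proof.
move=> rf; elim: n => [|n IHn].
  by rewrite (_ : (fun e => _) = fun=> 1); [exact: regular0_cst|exact/funext].
rewrite (_ : (fun e => _) = (fun e => f e * f e ^+ n)); first exact: regular0M.
by apply/funext => e; rewrite exprS.
Qed.

Lemma coef2_jet f a b c : jet2 f a b c -> coef2 f c.
Proof. by move=> jf; exists f, a, b. Qed.

Lemma eq_coef2 f g c : (forall e, 0 < e < 1 / 2 -> f e = g e) ->
  coef2 f c -> coef2 g c.
Proof.
move=> fg [h [a [b [jh fh]]]]; exists h, a, b; split=> // e e01.
by rewrite -fg// fh.
Qed.

Lemma coef2_unique f c c' : coef2 f c -> coef2 f c' -> c = c'.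
Proof.
move=> [g [a [b [jg fg]]]] [g' [a' [b' [jg' fg']]]].
have j := jet2D jg (jet2M (jet2_cst (-1)) jg').
apply/eqP; rewrite -subr_eq0; apply/eqP.
have -> : c - c' = c + (-1 * c' + 0 * b' + 0 * a') by ring.
apply: (@jet2_eq0 _ _ _ _ _ (1 / 2) _ _ j); first by rewrite divr_gt0.
by move=> e e01; rewrite -fg// -fg'// mulN1r subrr.
Qed.

Lemma coef2D f g c c' : coef2 f c -> coef2 g c' ->
  coef2 (fun e => f e + g e) (c + c').
Proof.
move=> [f' [a [b [jf ff]]]] [g' [a' [b' [jg gg]]]].
by do 3!eexists; split; [exact: jet2D jf jg|move=> e e01; rewrite /= ff// gg].
Qed.

Lemma coef2Z f c k : coef2 f c -> coef2 (fun e => k * f e) (k * c).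
Proof.
move=> [f' [a [b [jf ff]]]].
have -> : k * c = k * c + 0 * b + 0 * a by ring.
do 3!eexists; split; first exact: jet2M (jet2_cst k) jf.
by move=> e e01; rewrite /= ff.
Qed.

Lemma coef2_sum I (r : seq I) (F : I -> R -> R) (c : I -> R) :
  (forall i, coef2 (F i) (c i)) ->
  coef2 (fun e => \sum_(i <- r) F i e) (\sum_(i <- r) c i).
Proof.
move=> cF; elim: r => [|i r IHr].
  rewrite big_nil; apply: eq_coef2 (coef2_jet (jet2_cst 0)) => e _.
  by rewrite big_nil.
rewrite big_cons; apply: eq_coef2 (coef2D (cF i) IHr) => e _.
by rewrite big_cons.
Qed.

Lemma jet2_X3 : jet2 (fun e : R => e ^+ 3) 0 0 0.
Proof.
have := jet2M (jet2M (jet2_id R) (jet2_id R)) (jet2_id R).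
rewrite !(mul0r, mulr0, mulr1, mul1r, add0r, addr0).
by rewrite (_ : (fun e => _) = (fun e => e ^+ 3))//; apply/funext => e; ring.
Qed.

(** The factor e^3 leaves no term of order below 3, so summands without a pole at e = 0 can be added
    or dropped freely. *)
Lemma coef2_regular f : regular0 f -> coef2 (fun e => e ^+ 3 * f e) 0.
Proof.
move=> [a [b [c jf]]].
by have := coef2_jet (jet2M jet2_X3 jf); rewrite !mul0r !addr0.
Qed.

End Coef2.

(** * Residue sums of rational functions with integer poles *)

Section Residues.
Variable R : realType.
Implicit Types (e s tau : R) (C : seq nat).

Lemma natr_sub_eps_neq0 (c i : nat) e : 0 < e < 1 / 2 -> c%:R - (i%:R - e) != 0.
Proof.
move=> /andP[e0 e1]; have [ic|ci] := leqP i c.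
  have ic' : i%:R <= c%:R :> R by rewrite ler_nat.
  by apply: lt0r_neq0; lra.
have : c.+1%:R <= i%:R :> R by rewrite ler_nat.
by rewrite -natr1 => h; apply: ltr0_neq0; lra.
Qed.

(** Only the summand i = a is singular; with e^3 it becomes e^(3 - m) / (a - tau - e). The geometric
    series of 1 / (a - tau - e) has (a - tau)^(-m) as coefficient of e^(m - 1). *)
Lemma coef2_single_pole (M m a : nat) tau :
  (forall i : nat, (i < M)%N -> i%:R != tau) ->
  (a < M)%N -> (0 < m <= 3)%N ->
  coef2 (fun e => e ^+ 3 * \sum_(i < M)
      ((a%:R - (i%:R - e)) ^+ m)^-1 / (i%:R - e - tau))
    ((a%:R - tau) ^+ m)^-1.
Proof.
move=> Mtau aM m13; pose oa := Ordinal aM.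
have at0 : a%:R - tau != 0 by rewrite subr_eq0 Mtau.
have reg : coef2 (fun e => e ^+ 3 * \sum_(i < M | i != oa)
      ((a%:R - (i%:R - e)) ^+ m)^-1 / (i%:R - e - tau)) 0.
  apply: coef2_regular; apply: regular0_sum => i ia; apply: regular0M.
    apply: regular0V; last first.
      apply: regular0X; apply: regular0B; first exact: regular0_cst.
      by apply: regular0B; [exact: regular0_cst|exact: regular0_id].
    by rewrite subr0 expf_neq0// subr_eq0 eqr_nat eq_sym.
  apply: regular0V; first by rewrite subr0 subr_eq0 Mtau.
  apply: regular0B; last exact: regular0_cst.
  by apply: regular0B; [exact: regular0_cst|exact: regular0_id].
have jV : jet2 (fun e => (a%:R - tau + -1 * e)^-1) (a%:R - tau)^-1
    ((a%:R - tau) ^+ 2)^-1 ((a%:R - tau) ^+ 3)^-1.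
  have := jet2D (jet2_cst (a%:R - tau)) (jet2M (jet2_cst (-1)) (jet2_id R)).
  rewrite !(mul0r, mulr0, mulr1, mul1r, add0r, addr0) => /(jet2V at0).
  by rewrite opprK mul1r mul0r subr0 sqrrN expr1n mul1r.
have main : coef2 (fun e => e ^+ (3 - m) * (a%:R - tau + -1 * e)^-1)
    ((a%:R - tau) ^+ m)^-1.
  case: m m13 {reg} => [|[|[|[|m]]]]// _.
  - have := coef2_jet (jet2M (jet2M (jet2_id R) (jet2_id R)) jV).
    rewrite !(mul0r, mulr0, mulr1, mul1r, add0r, addr0).
    by rewrite expr1; apply: eq_coef2 => e _; rewrite expr2.
  - have := coef2_jet (jet2M (jet2_id R) jV).
    by rewrite !(mul0r, mulr0, mulr1, mul1r, add0r, addr0).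
  - have := coef2_jet jV.
    by apply: eq_coef2 => e _; rewrite mul1r.
have := coef2D main reg; rewrite addr0; apply: eq_coef2 => e e01.
rewrite [in RHS](bigD1 oa)//= mulrDr; congr (_ + _).
have e0 : e != 0 by rewrite gt_eqF//; case/andP: e01.
have -> : a%:R - (a%:R - e) = e by ring.
rewrite mulrA; congr (_ * _^-1); last by ring.
by case/andP: m13 => _ m3; rewrite -{2}(subnK m3) exprD mulfK// expf_neq0.
Qed.

(* The residues of a proper rational function sum to zero: two distinct poles
   are separated by partial fractions until a single pole is left *)
Lemma coef2_residues (M : nat) tau C :
  (forall i : nat, (i < M)%N -> i%:R != tau) ->
  all (fun c => (c < M)%N) C -> (0 < size C)%N ->
  (forall a, (count_mem a C <= 3)%N) ->
  coef2 (fun e => e ^+ 3 * \sum_(i < M)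
      (\prod_(c <- C) (c%:R - (i%:R - e)))^-1 / (i%:R - e - tau))
    (\prod_(c <- C) (c%:R - tau))^-1.
Proof.
move=> Mtau; have [k] := ubnP (size C); elim: k C => // k IHk [|a C]// sC.
move=> allC _ countC; move: (allC) => /= /andP[aM aC].
have [/all_pred1P eqC|] := boolP (all (pred1 a) C).
  have m3 : (0 < (size C).+1 <= 3)%N.
    by have := countC a; rewrite /= eqxx {1}eqC count_nseq/= eqxx mul1n.
  have prodE x : \prod_(c <- a :: C) (c%:R - x) = (a%:R - x) ^+ (size C).+1 :> R.
    by rewrite big_cons eqC size_nseq big_nseq iter_mulr_1 exprS.
  rewrite prodE; have := coef2_single_pole Mtau aM m3.
  apply: eq_coef2 => e _; congr (_ * _); apply: eq_bigr => i _.
  by rewrite prodE.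
rewrite -has_predC => /hasP[b bC /= ba].
have pC := perm_to_rem bC; set D := rem b C in pC.
have prodE x : \prod_(c <- a :: C) (c%:R - x) =
    (a%:R - x) * (b%:R - x) * \prod_(c <- D) (c%:R - x) :> R.
  by rewrite big_cons (perm_big _ pC)/= big_cons mulrA.
have sD : size C = (size D).+1 by rewrite (perm_size pC).
have cC x : count_mem x C = ((b == x) + count_mem x D)%N.
  by rewrite (permP pC).
have allD : all (fun c => (c < M)%N) D by have := aC; rewrite (perm_all _ pC) => /andP[].
have bM : (b < M)%N by have := aC; rewrite (perm_all _ pC) => /andP[].
have IH x : (x == a) || (x == b) -> coef2 (fun e => e ^+ 3 * \sum_(i < M)
      (\prod_(c <- x :: D) (c%:R - (i%:R - e)))^-1 / (i%:R - e - tau))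
    (\prod_(c <- x :: D) (c%:R - tau))^-1.
  move=> xab; apply: IHk => //=.
  - by move: sC; rewrite /= sD ltnS.
  - by rewrite allD andbT; case/orP: xab => /eqP ->.
  - move=> y; have := countC y; rewrite /= cC => h.
    apply: leq_trans h; case/orP: xab => /eqP ->.
      by rewrite leq_add2l leq_addl.
    by rewrite leq_addl.
have ab0 : b%:R - a%:R != 0 :> R by rewrite subr_eq0 eqr_nat.
(* Partial fractions: 1 / ((a - x) (b - x)) = (1 / (a - x) - 1 / (b - x)) / (b - a). Both resulting
   lists are one shorter, and no multiplicity grows. *)
have split x : a%:R - x != 0 -> b%:R - x != 0 ->
  (\prod_(c <- a :: C) (c%:R - x))^-1 = (b%:R - a%:R)^-1 *
   ((\prod_(c <- a :: D) (c%:R - x))^-1 + -1 * (\prod_(c <- b :: D) (c%:R - x))^-1) :> R.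
  move=> ax bx; rewrite prodE !big_cons !invfM.
  set P := (\prod_(c <- D) (c%:R - x))^-1.
  by field; rewrite ax bx ab0.
have Ha := IH a; have Hb := IH b; rewrite eqxx orbT in Hb; rewrite eqxx in Ha.
rewrite split ?subr_eq0 ?Mtau//.
have := coef2Z (b%:R - a%:R)^-1 (coef2D (Ha isT) (coef2Z (-1) (Hb isT))).
apply: eq_coef2 => e e01.
set S1 := \sum_(i < M) _; set S2 := \sum_(i < M) _.
have -> : (b%:R - a%:R)^-1 * (e ^+ 3 * S1 + -1 * (e ^+ 3 * S2)) =
  e ^+ 3 * ((b%:R - a%:R)^-1 * (S1 + -1 * S2)) by ring.
congr (_ * _); rewrite /S1 /S2 [-1 * _]mulr_sumr -big_split /= mulr_sumr.
apply: eq_bigr => i _.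
rewrite split ?natr_sub_eps_neq0//; set z := (_ - tau)^-1; ring.
Qed.

End Residues.

(** * The alternating functional *)

(* With s = i - N - e, the i-th summand of [alt_functional] below is
   (-1)^(i - N) * (sum of (-1)^k / (k - 1/2 - e) for k from 1 to i - N),
   extended to i < N so that consecutive values add up to 1 / (s + 1/2). *)
Definition alt_sum (R : realType) (N i : nat) (e : R) : R :=
  let a k := (-1) ^+ k.+1 / (k%:R - e - (N%:R - 1 / 2)) in
  (-1) ^+ i * (\sum_(k < i) a k - \sum_(k < N) a k).

(** The functional L before the coefficient of e^2 is taken. The offset [N] lets naturals index the
    integers from -N to M - N - 1, and e^3 clears triple poles. *)
Definition alt_functional (R : realType) (N M : nat) (f : R -> R) (e : R) : R :=
  e ^+ 3 * \sum_(i < M) f (i%:R - N%:R - e) * alt_sum N i e.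

Section AltFunctional.
Variable R : realType.
Implicit Types (f g : R -> R) (e s c : R) (C : seq nat).

Lemma half_natr_neq0 (i N : nat) : i%:R - (N%:R - 1 / 2) != 0 :> R.
Proof.
apply/eqP => h.
have /eqP : (2 * i + 1)%:R = (2 * N)%:R :> R by rewrite natrD !natrM; lra.
by rewrite eqr_nat => /eqP; lia.
Qed.

Lemma alt_sum_base N e : alt_sum N N e = 0 :> R.
Proof. by rewrite /alt_sum subrr mulr0. Qed.

Lemma alt_sumS N i e :
  alt_sum N i e + alt_sum N i.+1 e = (i%:R - e - (N%:R - 1 / 2))^-1.
Proof.
rewrite /alt_sum big_ord_recr /= exprS; set x := (_ - _ - (_ : R))^-1.
set A := \sum_(k < i) _; set B := \sum_(k < N) _.
have h : (-1) ^+ i * (-1) ^+ i = 1 :> R by rewrite -expr2 sqrr_sign.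
transitivity ((-1) ^+ i * (-1) ^+ i * x); last by rewrite h mul1r.
by ring.
Qed.

Lemma regular0_alt_sum N i : regular0 (@alt_sum R N i).
Proof.
have rS m : regular0 (fun e : R =>
    \sum_(k < m) (-1) ^+ k.+1 / (k%:R - e - (N%:R - 1 / 2))).
  apply: regular0_sum => k _; apply: regular0M; first exact: regular0_cst.
  apply: regular0V; first by rewrite subr0 half_natr_neq0.
  apply: regular0B; last exact: regular0_cst.
  by apply: regular0B; [exact: regular0_cst|exact: regular0_id].
by apply: regular0M; [exact: regular0_cst|exact: regular0B].
Qed.

Lemma alt_functionalD N M f g e : alt_functional N M (fun s => f s + g s) e =
  alt_functional N M f e + alt_functional N M g e.
Proof.
rewrite /alt_functional -mulrDr -big_split /=; congr (_ * _).
by apply: eq_bigr => i _; rewrite mulrDl.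
Qed.

Lemma alt_functionalZ N M k f e :
  alt_functional N M (fun s => k * f s) e = k * alt_functional N M f e.
Proof.
rewrite /alt_functional [RHS]mulrCA; congr (_ * _); rewrite mulr_sumr.
by apply: eq_bigr => i _; rewrite -mulrA.
Qed.

Lemma alt_functional_sum N M I (r : seq I) (F : I -> R -> R) e :
  alt_functional N M (fun s => \sum_(l <- r) F l s) e =
  \sum_(l <- r) alt_functional N M (F l) e.
Proof.
rewrite /alt_functional -[RHS]mulr_sumr exchange_big /=; congr (_ * _).
by apply: eq_bigr => i _; rewrite mulr_suml.
Qed.

(** Summation by parts: shifting the index in the sum with f(s - 1) pairs consecutive values of
    [alt_sum], which [alt_sumS] adds up. Two boundary terms remain. *)
Lemma alt_functional_shift N M f e :
  alt_functional N M.+1 (fun s => f s + f (s - 1)) e =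
  e ^+ 3 * \sum_(i < M.+1) f (i%:R - N%:R - e) / (i%:R - e - (N%:R - 1 / 2)) +
  e ^+ 3 * (f (- N%:R - 1 - e) * alt_sum N 0 e
            - f (M%:R - N%:R - e) * alt_sum N M.+1 e).
Proof.
rewrite /alt_functional -mulrDr; congr (_ * _).
transitivity (\sum_(i < M.+1) f (i%:R - N%:R - e) * alt_sum N i e +
   \sum_(i < M.+1) f (i%:R - N%:R - e - 1) * alt_sum N i e).
  by rewrite -big_split; apply: eq_bigr => i _; rewrite /= mulrDl.
rewrite [X in _ + X]big_ord_recl /=.
have -> : 0 - N%:R - e - 1 = - N%:R - 1 - e by ring.
have -> : \sum_(i < M) f ((bump 0 i)%:R - N%:R - e - 1) * alt_sum N (bump 0 i) e
    = \sum_(i < M.+1) f (i%:R - N%:R - e) * alt_sum N i.+1 e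
      - f (M%:R - N%:R - e) * alt_sum N M.+1 e.
  rewrite big_ord_recr /= addrK; apply: eq_bigr => i _.
  have -> : bump 0 i = i.+1 by [].
  by congr (f _ * _); rewrite -natr1; ring.
set S1 := \sum_(i < M.+1) _; set S2 := \sum_(i < M.+1) f _ * alt_sum N i.+1 e.
set A := f _ * _; set B := f _ * _.
have -> : S1 + (A + (S2 - B)) = S1 + S2 + (A - B) by ring.
congr (_ + _); rewrite /S1 /S2 -big_split; apply: eq_bigr => i _ /=.
by rewrite -mulrDr alt_sumS.
Qed.

(** The main sum is a residue sum with tau = N - 1/2, which is s = -1/2 after the offset. The
    boundary terms sit at s = -N - 1 and s = M - N, just outside the range of the poles, so they are
    regular and e^3 removes them. *)
Lemma coef2_alt_functional_shift N M C c :
  all (fun k => (k < M)%N) C -> (0 < size C)%N ->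
  (forall a, (count_mem a C <= 3)%N) ->
  let f s := c * (\prod_(k <- C) (k%:R - N%:R - s))^-1 in
  coef2 (alt_functional N M.+1 (fun s => f s + f (s - 1))) (f (- (1 / 2))).
Proof.
move=> allC sC cC f.
have tau (i : nat) : (i < M.+1)%N -> i%:R != N%:R - 1 / 2 :> R.
  by move=> _; rewrite -subr_eq0 half_natr_neq0.
have allC' : all (fun k => (k < M.+1)%N) C.
  by apply: sub_all allC => k; exact: ltnW.
have regf x : (forall k, k \in C -> k%:R - N%:R - x != 0) ->
    regular0 (fun e => f (x - e)).
  move=> xC; apply: regular0M; first exact: regular0_cst.
  apply: regular0V.
    by rewrite prodf_seq_neq0; apply/allP => k kC /=; rewrite subr0 xC.
  apply: regular0_prod => k; apply: regular0B; first exact: regular0_cst.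
  by apply: regular0B; [exact: regular0_cst|exact: regular0_id].
have bd : regular0 (fun e => f (- N%:R - 1 - e) * alt_sum N 0 e
            - f (M%:R - N%:R - e) * alt_sum N M.+1 e).
  apply: regular0B; apply: regular0M; try exact: regular0_alt_sum.
  - apply: regf => k _.
    have -> : k%:R - N%:R - (- N%:R - 1) = k.+1%:R :> R by rewrite -natr1; ring.
    by rewrite pnatr_eq0.
  - apply: regf => k /(allP allC) kM.
    have -> : k%:R - N%:R - (M%:R - N%:R) = k%:R - M%:R :> R by ring.
    by rewrite subr_eq0 eqr_nat ltn_eqF.
have := coef2D (coef2Z c (coef2_residues tau allC' sC cC)) (coef2_regular bd).
have -> : c * (\prod_(c0 <- C) (c0%:R - (N%:R - 1 / 2)))^-1 + 0 = f (- (1 / 2)).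
  by rewrite addr0; congr (_ * _^-1); apply: eq_bigr => k _; ring.
apply: eq_coef2 => e _; rewrite alt_functional_shift; congr (_ + _).
rewrite mulrCA; congr (_ * _); rewrite mulr_sumr; apply: eq_bigr => i _.
rewrite mulrA; congr (_ * _^-1 / _); apply: eq_bigr => k _; ring.
Qed.

End AltFunctional.

(** * The well-poised summands *)

Section Pochhammer.
Variable R : realType.
Implicit Types (a x s : R).

Lemma pochhammer0 a : pochhammer a 0 = 1.
Proof. by rewrite /pochhammer big_ord0. Qed.

Lemma pochhammerSl a k : pochhammer a k.+1 = a * pochhammer (a + 1) k.
Proof.
rewrite /pochhammer big_ord_recl addr0; congr (_ * _).
apply: eq_bigr => i _; have -> : nat_of_ord (lift ord0 i) = i.+1 by [].
by rewrite -natr1; ring.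
Qed.

Lemma pochhammerSr a k : pochhammer a k.+1 = pochhammer a k * (a + k%:R).
Proof. by rewrite /pochhammer big_ord_recr. Qed.

Lemma pochhammerD a k m :
  pochhammer a (k + m) = pochhammer a k * pochhammer (a + k%:R) m.
Proof.
elim: m => [|m IHm]; first by rewrite addn0 pochhammer0 mulr1.
by rewrite addnS !pochhammerSr IHm natrD; ring.
Qed.

Lemma pochhammer_neq0 a k :
  (forall i, (i < k)%N -> a + i%:R != 0) -> pochhammer a k != 0.
Proof. by move=> h; apply/prodf_neq0 => i _; exact: h. Qed.

Lemma prod_iota (N m k : nat) s :
  \prod_(c <- iota m k) (c%:R - N%:R - s) = pochhammer (m%:R - N%:R - s) k.
Proof.
elim: k m => [|k IHk] m; first by rewrite big_nil pochhammer0.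
rewrite /= big_cons IHk pochhammerSl; congr (_ * pochhammer _ _).
by rewrite -natr1; ring.
Qed.

End Pochhammer.

(* These summands arise on expanding the numerator (t - n)_n (t + n)_n of
   the n-th summand of G_n by the Pfaff-Saalschuetz identity, with t = 1/2 - s. *)
Definition kappa (R : realType) (n l : nat) (s : R) : R :=
  n`!%:R * l`!%:R ^+ 2 * (n%:R / 2 - s) /
  (pochhammer (- s) n.+1 * pochhammer (- s) l.+1
   * pochhammer (n%:R - l%:R - s) l.+1).

(** The f with kappa_(n+1,l) - kappa_(n,l) = f(s) + f(s - 1), see [kappaS]; its numerator is
    constant and its poles have order at most 3. *)
Definition kappa_cert (R : realType) (n l : nat) (s : R) : R :=
  - (1 / 2) * (n`!%:R * l`!%:R ^+ 2) /
  (pochhammer (- s) n.+1 * pochhammer (- s) l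
   * pochhammer (n%:R - l%:R - s) l.+1).

(** The analogous f for kappa_(0,l+1) + kappa_(0,l), see [kappa0S]. *)
Definition kappa0_cert (R : realType) (l : nat) (s : R) : R :=
  1 / 2 * l`!%:R ^+ 2 /
  (pochhammer (- s) l.+1 * pochhammer (- l.+1%:R - s) l.+1).

Definition noninteger (R : realType) (s : R) : Prop :=
  forall a b : nat, a%:R - b%:R - s != 0.

(** The value L(kappa_(0,l)), computed by applying L(f(s) + f(s - 1)) = f(-1/2) to the recurrence
    [kappa0S]. *)
Fixpoint mu0 (R : realType) (l : nat) : R :=
  if l is k.+1 then - mu0 R k + kappa0_cert k (- (1 / 2)) else 0.

Definition mu (R : realType) (n l : nat) : R :=
  mu0 R l + \sum_(m < n) kappa_cert m l (- (1 / 2)).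

Section Kappa.
Variable R : realType.
Implicit Types (s e : R).

Lemma nonintegerS s (a b c : nat) :
  noninteger s -> a%:R - b%:R - s + c%:R != 0.
Proof.
move=> h; have := h (a + c)%N b; rewrite natrD.
by have -> : a%:R + c%:R - b%:R - s = a%:R - b%:R - s + c%:R by ring.
Qed.

Lemma noninteger_pochhammer s (a b k : nat) :
  noninteger s -> pochhammer (a%:R - b%:R - s) k != 0.
Proof. by move=> h; apply: pochhammer_neq0 => i _; exact: nonintegerS. Qed.

Lemma noninteger_eps (i N : nat) e :
  0 < e < 1 / 2 -> noninteger (i%:R - N%:R - e).
Proof.
move=> e01 a b.
have := natr_sub_eps_neq0 (a + N) (i + b) e01; rewrite !natrD.
by have -> : a%:R + N%:R - (i%:R + b%:R - e) = a%:R - b%:R - (i%:R - N%:R - e)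
  by ring.
Qed.

Lemma kappaS n l s : noninteger s ->
  kappa n.+1 l s = kappa n l s + (kappa_cert n l s + kappa_cert n l (s - 1)).
Proof.
move=> hs; rewrite /kappa /kappa_cert.
have s0 : - s != 0 by have := hs 0 0; rewrite subrr sub0r.
have ns0 : n%:R + 1 - s != 0.
  by have := hs n.+1 0; rewrite subr0 -natr1.
have ls0 : l%:R - s != 0 by have := hs l 0; rewrite subr0.
have nls0 : n%:R - l%:R - s != 0 by exact: hs.
(* Every Pochhammer symbol is reduced to the blocks [X], [Y], [Z] and linear factors, which leaves
   an identity of rational functions. *)
set X := pochhammer (1 - s) n.
set Y := pochhammer (1 - s) l.
set Z := pochhammer (n%:R + 1 - l%:R - s) l.
have X0 : X != 0 by have := noninteger_pochhammer 1 0 n hs; rewrite subr0.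
have Y0 : Y != 0 by have := noninteger_pochhammer 1 0 l hs; rewrite subr0.
have Z0 : Z != 0.
  by have := noninteger_pochhammer n.+1 l l hs; rewrite -natr1.
have E1 : pochhammer (- s) n.+2 = - s * X * (n%:R + 1 - s).
  by rewrite pochhammerSl pochhammerSr [- s + 1]addrC -/X; ring.
have E2 : pochhammer (- s) l.+1 = - s * Y by rewrite pochhammerSl [- s + 1]addrC.
have E3 : pochhammer (n.+1%:R - l%:R - s) l.+1 = Z * (n%:R + 1 - s).
  by rewrite pochhammerSr -natr1 -/Z; congr (_ * _); ring.
have E4 : pochhammer (- s) n.+1 = - s * X by rewrite pochhammerSl [- s + 1]addrC.
have E5 : pochhammer (n%:R - l%:R - s) l.+1 = (n%:R - l%:R - s) * Z.
  by rewrite pochhammerSl; congr (_ * pochhammer _ _); ring.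
(* Dividing by l - s, instead of splitting off a factor, covers l = 0 as well. *)
have E6 : pochhammer (- s) l = - s * Y / (l%:R - s).
  rewrite -E2 pochhammerSr; apply: canRL (mulfK ls0) _.
  by congr (_ * _); ring.
have E7 : pochhammer (- (s - 1)) n.+1 = X * (n%:R + 1 - s).
  have -> : - (s - 1) = 1 - s by ring.
  by rewrite pochhammerSr -/X; congr (_ * _); ring.
have E8 : pochhammer (- (s - 1)) l = Y by congr pochhammer; ring.
have E9 : pochhammer (n%:R - l%:R - (s - 1)) l.+1 = Z * (n%:R + 1 - s).
  rewrite -E3 -natr1; congr pochhammer; ring.
rewrite {}E1 {}E3 {}E4 {}E5 {}E7 {}E8 {}E9 {}E2 {}E6 factS natrM -natr1.
field; rewrite X0 Y0 Z0 ns0 ls0 nls0 /=.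
by rewrite -oppr_eq0 s0.
Qed.

Lemma kappa0S l s : noninteger s ->
  kappa 0 l.+1 s = - kappa 0 l s + (kappa0_cert l s + kappa0_cert l (s - 1)).
Proof.
move=> hs; rewrite /kappa /kappa0_cert.
have s0 : - s != 0 by have := hs 0 0; rewrite subrr sub0r.
have ls0 : l%:R + 1 - s != 0 by have := hs l.+1 0; rewrite subr0 -natr1.
have ls1 : - l%:R - 1 - s != 0.
  have := hs 0 l.+1; rewrite -natr1.
  by have -> : 0%:R - (l%:R + 1) - s = - l%:R - 1 - s by ring.
set Y := pochhammer (1 - s) l.
set W := pochhammer (- l%:R - s) l.
have Y0 : Y != 0 by have := noninteger_pochhammer 1 0 l hs; rewrite subr0.
have W0 : W != 0 by have := noninteger_pochhammer 0 l l hs; rewrite sub0r.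
have E1 : pochhammer (- s) 1 = - s by rewrite pochhammerSl pochhammer0 mulr1.
have E2 : pochhammer (- s) l.+1 = - s * Y by rewrite pochhammerSl [- s + 1]addrC.
have E3 : pochhammer (- s) l.+2 = - s * Y * (l%:R + 1 - s).
  by rewrite pochhammerSr E2 -natr1; congr (_ * _); ring.
have E4 : pochhammer (0%:R - l%:R - s) l.+1 = W * (- s).
  by rewrite pochhammerSr sub0r -/W; congr (_ * _); ring.
have E5 : pochhammer (0%:R - l.+1%:R - s) l.+2 = (- l%:R - 1 - s) * W * (- s).
  rewrite pochhammerSl -mulrA -E4 -natr1.
  by congr (_ * pochhammer _ _); ring.
have E6 : pochhammer (- l.+1%:R - s) l.+1 = (- l%:R - 1 - s) * W.
  by rewrite pochhammerSl -natr1; congr (_ * pochhammer _ _); ring.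
have E7 : pochhammer (- (s - 1)) l.+1 = Y * (l%:R + 1 - s).
  have -> : - (s - 1) = 1 - s by ring.
  by rewrite pochhammerSr -/Y; congr (_ * _); ring.
have E8 : pochhammer (- l.+1%:R - (s - 1)) l.+1 = W * (- s).
  by rewrite -E4 -natr1; congr pochhammer; ring.
rewrite {}E1 {}E3 {}E4 {}E5 {}E7 {}E8 {}E6 {}E2 fact0 factS natrM -[l.+1%:R]natr1.
field; rewrite Y0 W0 ls0 ls1 /=.
by rewrite -oppr_eq0 s0.
Qed.

(** The function kappa_(0,0) is 1 / s^2. Its only pole s = 0 has index i = N, exactly where
    [alt_sum] vanishes; all other summands are regular. *)
Lemma coef2_kappa00 N M : (N < M)%N -> coef2 (alt_functional N M (@kappa R 0 0)) 0.
Proof.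
move=> NM; pose oN := Ordinal NM.
have K0 s : kappa 0 0 s = s / s ^+ 3 :> R.
  rewrite /kappa !pochhammerSl !pochhammer0 !mulr1 mul0r !sub0r mul1r expr1n mul1r.
  have -> : - s * - s * (- 0 - s) = - s ^+ 3 by ring.
  by rewrite invrN mulrNN.
have reg : regular0 (fun e : R => \sum_(i < M | i != oN)
    kappa 0 0 (i%:R - N%:R - e) * alt_sum N i e).
  apply: regular0_sum => i iN; apply: regular0M; last exact: regular0_alt_sum.
  rewrite (_ : (fun e => _) = (fun e => (i%:R - N%:R - e) / (i%:R - N%:R - e) ^+ 3));
    last by apply/funext => e; rewrite K0.
  have r : regular0 (fun e : R => i%:R - N%:R - e).
    by apply: regular0B; [exact: regular0_cst|exact: regular0_id].
  apply: regular0M => //; apply: regular0V; last exact: regular0X.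
  by rewrite subr0 expf_neq0// subr_eq0 eqr_nat.
have := coef2_regular reg; apply: eq_coef2 => e _.
rewrite /alt_functional [in RHS](bigD1 oN)//= alt_sum_base mulr0 add0r.
by congr (_ * _).
Qed.

Lemma count_iota_le1 m k a : (count_mem a (iota m k) <= 1)%N.
Proof. by rewrite count_uniq_mem ?iota_uniq ?leq_b1. Qed.

Lemma all_ltn_iota m k M : (m + k <= M)%N -> all (fun c => (c < M)%N) (iota m k).
Proof.
by move=> h; apply/allP => c; rewrite mem_iota => /andP[_ /leq_trans]; exact.
Qed.

Lemma coef2_kappa0 N M l : (l <= N)%N -> (N + l < M)%N ->
  coef2 (alt_functional N M.+1 (@kappa R 0 l)) (mu0 R l).
Proof.
elim: l => [|l IHl] lN lM; first by apply: coef2_kappa00; lia.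
have {}IHl := IHl (ltnW lN) (ltac:(lia) : (N + l < M)%N).
(* Indices of the poles of [kappa0_cert], offset by [N]: s = 0, ..., l and s = -(l + 1), ..., -1. *)
pose C := iota N l.+1 ++ iota (N - l.+1) l.+1.
pose c : R := 1 / 2 * l`!%:R ^+ 2.
have certE s : kappa0_cert l s = c * (\prod_(k <- C) (k%:R - N%:R - s))^-1.
  rewrite /kappa0_cert big_cat !prod_iota subrr sub0r natrB//.
  by have -> : N%:R - l.+1%:R - N%:R = - l.+1%:R :> R by ring.
have allC : all (fun k => (k < M)%N) C.
  by rewrite all_cat !all_ltn_iota//; lia.
have cC a : (count_mem a C <= 3)%N.
  rewrite count_cat; have := count_iota_le1 N l.+1 a.
  have := count_iota_le1 (N - l.+1) l.+1 a; lia.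
have := coef2_alt_functional_shift N c allC isT cC.
move=> /(coef2D (coef2Z (-1) IHl)); rewrite -certE /= mulN1r.
apply: eq_coef2 => e e01; rewrite -alt_functionalZ -alt_functionalD.
rewrite /alt_functional; congr (_ * _); apply: eq_bigr => i _.
by rewrite kappa0S ?mulN1r ?certE//; exact: noninteger_eps.
Qed.

Lemma coef2_kappa N M n l : (l <= N)%N -> (N + maxn n l < M)%N ->
  coef2 (alt_functional N M.+1 (@kappa R n l)) (mu R n l).
Proof.
move=> lN; elim: n => [|n IHn] nM.
  by rewrite /mu big_ord0 addr0; apply: coef2_kappa0 => //; lia.
have {}IHn := IHn (ltac:(lia) : (N + maxn n l < M)%N).
(* The poles 0, ..., n, then 0, ..., l - 1, then n - l, ..., n, offset by [N]. None of the three
   runs repeats a pole, so each multiplicity is at most 3. *)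
pose C := iota N n.+1 ++ iota N l ++ iota (N + n - l) l.+1.
pose c : R := - (1 / 2) * (n`!%:R * l`!%:R ^+ 2).
have certE s : kappa_cert n l s = c * (\prod_(k <- C) (k%:R - N%:R - s))^-1.
  rewrite /kappa_cert !big_cat !prod_iota subrr sub0r natrB; last by lia.
  rewrite natrD; have -> : N%:R + n%:R - l%:R - N%:R = n%:R - l%:R :> R by ring.
  by congr (_ * _^-1); rewrite -mulrA.
have allC : all (fun k => (k < M)%N) C.
  by rewrite !all_cat !all_ltn_iota//; lia.
have cC a : (count_mem a C <= 3)%N.
  rewrite !count_cat; have := count_iota_le1 N n.+1 a.
  have := count_iota_le1 N l a; have := count_iota_le1 (N + n - l) l.+1 a; lia.
have := coef2_alt_functional_shift N c allC isT cC.
move=> /(coef2D IHn); rewrite -certE /= /mu big_ord_recr /= addrA.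
apply: eq_coef2 => e e01; rewrite -alt_functionalD.
rewrite /alt_functional; congr (_ * _); apply: eq_bigr => i _.
by rewrite kappaS ?certE//; exact: noninteger_eps.
Qed.

End Kappa.

(** * The Pfaff-Saalschuetz expansion *)

Section Saalschuetz.
Variable R : realType.
Implicit Types (a b c s : R).

Lemma pochhammer_oppr a k :
  pochhammer a k = (-1) ^+ k * pochhammer (1 - a - k%:R) k.
Proof.
elim: k => [|k IHk]; first by rewrite !pochhammer0 mulr1.
rewrite pochhammerSr IHk pochhammerSl exprS -natr1.
have -> : 1 - a - (k%:R + 1) + 1 = 1 - a - k%:R by ring.
by ring.
Qed.

(* The induction step rests on the decomposition
   (c - a) (c - b) = (c + k) (c - a - b - k) + (a + k) (b + k). *)
Lemma pfaff_saalschuetz n a b c :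
  \sum_(k < n.+1) 'C(n, k)%:R * (pochhammer a k * pochhammer b k *
     pochhammer (c + k%:R) (n - k)) * pochhammer (c - a - b) (n - k) =
  pochhammer (c - a) n * pochhammer (c - b) n.
Proof.
elim: n c => [|n IHn] c.
  by rewrite big_ord_recl big_ord0 !pochhammer0 bin0; ring.
pose d := c - a - b.
pose A k := pochhammer a k * pochhammer b k * pochhammer (c + k%:R) (n.+1 - k).
pose D j := pochhammer (d + 1) j.
pose P j := pochhammer d j.
have PS j : P j.+1 = d * D j by rewrite /P pochhammerSl.
have DS j : D j.+1 = D j * (d + 1 + j%:R) by rewrite /D pochhammerSr.
have PD j : P j.+1 - D j.+1 = - (j.+1%:R * D j).
  by rewrite PS DS -natr1; ring.
(* The induction hypothesis at c + 1, with the factor (c - a) (c - b) decomposed separately for each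
   k. *)
have RE : pochhammer (c - a) n.+1 * pochhammer (c - b) n.+1 =
    \sum_(k < n.+1) 'C(n, k)%:R * ((d - k%:R) * A k + A k.+1) * D (n - k)%N.
  transitivity ((c - a) * (c - b) *
      (pochhammer (c + 1 - a) n * pochhammer (c + 1 - b) n)).
    rewrite !pochhammerSl.
    have -> : c - a + 1 = c + 1 - a by ring.
    have -> : c - b + 1 = c + 1 - b by ring.
    by ring.
  rewrite -IHn mulr_sumr; apply: eq_bigr => k _.
  have kn : (k <= n)%N by rewrite -ltnS.
  have -> : c + 1 - a - b = d + 1 by rewrite /d; ring.
  rewrite /A subSn// subSS [pochhammer _ (n - k).+1]pochhammerSl -/(D _).
  rewrite !pochhammerSr -natr1.
  have -> : c + k%:R + 1 = c + 1 + k%:R by ring.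
  have -> : c + (k%:R + 1) = c + 1 + k%:R by ring.
  by rewrite /d; ring.
(* Pascal's rule splits the binomials of the sum for n + 1. *)
rewrite {}RE; transitivity
  (\sum_(k < n.+1) 'C(n, k)%:R * (A k * P (n.+1 - k)%N + A k.+1 * P (n - k)%N)).
  rewrite big_ord_recl /=.
  transitivity (A 0%N * P n.+1 + (\sum_(k < n.+1) 'C(n, k.+1)%:R * A k.+1 * P (n - k)%N +
      \sum_(k < n.+1) 'C(n, k)%:R * A k.+1 * P (n - k)%N)).
    congr (_ + _); first by rewrite bin0 mul1r subn0.
    rewrite -big_split; apply: eq_bigr => k _ /=.
    by rewrite /bump add1n binS natrD subSS -/(A _) -/(P _); ring.
  rewrite big_ord_recr /= bin_small// !mul0r addr0 addrA.
  have -> : A 0%N * P n.+1 + \sum_(k < n) 'C(n, k.+1)%:R * A k.+1 * P (n - k)%N =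
      \sum_(k < n.+1) 'C(n, k)%:R * A k * P (n.+1 - k)%N.
    by rewrite [RHS]big_ord_recl /= bin0 mul1r subn0.
  by rewrite -big_split; apply: eq_bigr => k _ /=; ring.
apply/eqP; rewrite -subr_eq0 -sumrB; apply/eqP.
transitivity (\sum_(k < n.+1) 'C(n, k)%:R * k%:R * A k * D (n - k)%N +
   \sum_(k < n.+1) 'C(n, k)%:R * A k.+1 * (P (n - k)%N - D (n - k)%N)).
  rewrite -big_split; apply: eq_bigr => k _ /=.
  have kn : (k <= n)%N by rewrite -ltnS.
  by rewrite subSn// PS; ring.
rewrite big_ord_recl [X in _ + X]big_ord_recr /= mulr0 !mul0r add0r subnn.
have -> : P 0%N - D 0%N = 0 by rewrite /P /D !pochhammer0 subrr.
rewrite mulr0 addr0 -big_split big1// => k _ /=.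
have kn := ltn_ord k.
(* The two remaining sums cancel termwise, since (k + 1) C(n, k + 1) = (n - k) C(n, k). *)
rewrite /bump add1n -(subnSK kn) PD -natrM.
have -> : ('C(n, k.+1) * k.+1 = 'C(n, k) * (n - k.+1).+1)%N.
  by rewrite mulnC [RHS]mulnC mul_bin_left subnSK.
by rewrite natrM; ring.
Qed.

(** The function Rt: the summand of G_n without (-1)^k at k = 1/2 - s, where reversing (k - n)_n
    costs a sign (-1)^n. *)
Definition catalan_rat (n : nat) s : R :=
  n`!%:R * (n%:R / 2 - s) * (pochhammer (s + 1 / 2) n
    * pochhammer (n%:R + 1 / 2 - s) n) / pochhammer (- s) n.+1 ^+ 3.

(** The binomial coefficient C(a + l - 1/2, l). *)
Definition half_binom (a l : nat) : R := pochhammer (1 / 2 + a%:R) l / l`!%:R.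

Definition catalan_coef (n l : nat) : R :=
  'C(n, l)%:R * half_binom (n - l) l * half_binom n l.

(** Pfaff-Saalschuetz with a = -s, b = s - n and c = 1/2. In the k-th term (-s)_k and (s - n)_k
    cancel against two of the three copies of (-s)_(n+1), which leaves kappa_(n,n-k). *)
Lemma catalan_ratE n s : noninteger s ->
  catalan_rat n s =
  \sum_(k < n.+1) (-1) ^+ k * catalan_coef n (n - k) * kappa n (n - k) s.
Proof.
move=> hs; rewrite /catalan_rat.
have -> : pochhammer (s + 1 / 2) n * pochhammer (n%:R + 1 / 2 - s) n =
    pochhammer (1 / 2 - - s) n * pochhammer (1 / 2 - (s - n%:R)) n.
  by congr (pochhammer _ _ * pochhammer _ _); ring.
rewrite -pfaff_saalschuetz mulr_sumr mulr_suml; apply: eq_bigr => k _.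
have kn : (k <= n)%N by rewrite -ltnS.
set l := (n - k)%N; have nE : n = (k + l)%N by rewrite subnKC.
have nR : n%:R = k%:R + l%:R :> R by rewrite -natrD -nE.
have nl : (n - l = k)%N by rewrite subKn.
set Q := pochhammer (- s) n.+1.
have nz (u v m : nat) : pochhammer (u%:R - v%:R - s) m != 0 by exact: noninteger_pochhammer.
have Q1 : Q = pochhammer (- s) k * pochhammer (k%:R - s) l.+1.
  transitivity (pochhammer (- s) (k + l.+1)); first by rewrite addnS -nE.
  by rewrite pochhammerD [- s + _]addrC.
have Q2 : Q = pochhammer (- s) l.+1 * ((-1) ^+ k * pochhammer (s - n%:R) k).
  rewrite [pochhammer (s - _) k]pochhammer_oppr [_ ^+ k * _]mulrA -expr2 sqrr_sign mul1r.
  have -> : 1 - (s - n%:R) - k%:R = - s + l.+1%:R by rewrite nR -natr1; ring.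
  by rewrite /Q -pochhammerD; congr pochhammer; lia.
rewrite /catalan_coef /kappa nl /half_binom.
have -> : 1 / 2 - - s - (s - n%:R) = 1 / 2 + n%:R by ring.
have -> : n%:R - l%:R - s = k%:R - s by rewrite nR; ring.
rewrite bin_sub// -/Q.
have Q0 : Q != 0 by have := nz 0%N 0%N n.+1; rewrite subrr sub0r.
have A0 : pochhammer (- s) l.+1 != 0.
  by have := nz 0%N 0%N l.+1; rewrite subrr sub0r.
have B0 : pochhammer (k%:R - s) l.+1 != 0.
  by have := nz k 0%N l.+1; rewrite subr0.
have -> : pochhammer (- s) k = Q / pochhammer (k%:R - s) l.+1.
  by rewrite {1}Q1 mulfK.
have -> : pochhammer (s - n%:R) k = (-1) ^+ k * Q / pochhammer (- s) l.+1.
  apply: canRL (mulfK A0) _; rewrite mulrC Q2 [RHS]mulrCA; congr (_ * _).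
  by rewrite mulrA -expr2 sqrr_sign mul1r.
field; rewrite Q0 A0 B0 /=.
by rewrite pnatr_eq0 -lt0n fact_gt0.
Qed.

End Saalschuetz.

(** * Integrality *)

Section Integrality.
Variable R : realType.
Implicit Types (x : R).

Lemma half_binomS a l :
  half_binom R a.+1 l.+1 = half_binom R a l.+1 + half_binom R a.+1 l.
Proof.
rewrite /half_binom pochhammerSr [pochhammer (1 / 2 + a%:R) _]pochhammerSl.
have -> : 1 / 2 + a%:R + 1 = 1 / 2 + a.+1%:R :> R by rewrite -natr1; ring.
rewrite factS natrM -!natr1; field.
by rewrite natr1 !pnatr_eq0 -lt0n fact_gt0.
Qed.

Lemma pochhammer_half m :
  pochhammer (1 / 2) m * (4 ^+ m * m`!%:R) = (2 * m)`!%:R :> R.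
Proof.
elim: m => [|m IHm]; first by rewrite pochhammer0 !mul1r.
rewrite mulnS add2n !factS !natrM -IHm pochhammerSr exprS.
by rewrite -!natr1 natrM; field.
Qed.

Lemma pochhammer_half_neq0 m : pochhammer (1 / 2) m != 0 :> R.
Proof.
apply: pochhammer_neq0 => i _; rewrite gt_eqF// ltr_pwDl ?ler0n// divr_gt0//.
Qed.

Lemma fact_neq0 m : m`!%:R != 0 :> R.
Proof. by rewrite pnatr_eq0 -lt0n fact_gt0. Qed.

Lemma half_binom0 m : 4 ^+ m * half_binom R 0 m = 'C(2 * m, m)%:R.
Proof.
rewrite /half_binom addr0.
have := bin_fact (leq_addr m m).
rewrite addnK addnn -mul2n => /(congr1 (fun k : nat => k%:R : R)).
rewrite !natrM -pochhammer_half => h.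
have f0 := fact_neq0 m.
apply: (mulIf (mulf_neq0 f0 f0)); rewrite h.
by field.
Qed.

(** Pascal's rule [half_binomS] reduces to a = 0, the central binomial coefficient. *)
Lemma int_num_half_binom a l : 4 ^+ l * half_binom R a l \is a Num.int.
Proof.
elim: l a => [|l IHl] a.
  by rewrite /half_binom pochhammer0 expr0 mul1r divr1 rpred1.
elim: a => [|a IHa].
  rewrite half_binom0.
  exact: rpred_nat.
rewrite half_binomS mulrDr rpredD// exprS -mulrA rpredM//.
exact: (rpred_nat _ 4).
Qed.

(** Factorials of even numbers are split by [pochhammer_half]. Thanks to this identity the
    denominator (1/2)_l of [kappa_cert] is absorbed by c_l and costs no third factor d_(2n). *)
Lemma bin_half_binom n l : (l <= n)%N ->
  'C(n, l)%:R * half_binom R (n - l) l * (l`!%:R / pochhammer (1 / 2) l) =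
  'C(2 * n, 2 * l)%:R :> R.
Proof.
move=> ln.
have h1 : pochhammer (1 / 2) n =
    pochhammer (1 / 2) (n - l) * pochhammer (1 / 2 + (n - l)%:R) l :> R.
  by rewrite -pochhammerD subnK.
have h2 := pochhammer_half n; have h3 := pochhammer_half l.
have h4 := pochhammer_half (n - l).
have := bin_fact ln; move=> /(congr1 (fun k : nat => k%:R : R)).
rewrite !natrM => h5.
have l2 : (2 * l <= 2 * n)%N by rewrite leq_mul2l.
have := bin_fact l2; rewrite -mulnBr => /(congr1 (fun k : nat => k%:R : R)).
rewrite !natrM -h2 -h3 -h4 h1 -h5 => h6.
have p0 := pochhammer_half_neq0; have f0 := fact_neq0.
have q0 m : 4 ^+ m != 0 :> R by rewrite expf_neq0// pnatr_eq0.
rewrite /half_binom.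
have e4 : 4 ^+ n = 4 ^+ l * 4 ^+ (n - l) :> R by rewrite -exprD subnKC.
rewrite e4 in h6.
set K := pochhammer (1 / 2) l * (4 ^+ l * l`!%:R) *
  (pochhammer (1 / 2) (n - l) * (4 ^+ (n - l) * (n - l)`!%:R)) in h6.
have K0 : K != 0 by rewrite !mulf_neq0.
apply: (mulIf K0); rewrite h6 /K; field.
by rewrite p0 f0.
Qed.

Lemma dvdn_lcm_upto k m : (0 < k <= m)%N -> (k %| lcm_upto m)%N.
Proof.
move=> /andP[k0 km]; rewrite /lcm_upto (bigD1_seq k) ?iota_uniq//=.
  exact: dvdn_lcml.
by rewrite mem_index_iota k0.
Qed.

(** The denominator is half an odd integer of absolute value at most 2n - 1. *)
Lemma lcm_upto_half_inv n (a b : nat) : (b <= n)%N -> (a < n + b)%N ->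
  (lcm_upto (2 * n))%:R / (1 / 2 + a%:R - b%:R) / 2 \is a (@Num.int R).
Proof.
move=> bn anb; have [ba|ab] := leqP b a.
  have /dvdnP[q ->] : ((2 * (a - b)).+1 %| lcm_upto (2 * n))%N.
    by apply: dvdn_lcm_upto; lia.
  have h0 : (2 * (a - b)).+1%:R != 0 :> R by rewrite pnatr_eq0.
  have h1 : 1 / 2 + a%:R - b%:R = (2 * (a - b)).+1%:R / 2 :> R.
    by rewrite -[(2 * (a - b)).+1%:R]natr1 natrM natrB//; field.
  rewrite h1 natrM.
  have -> : q%:R * (2 * (a - b)).+1%:R / ((2 * (a - b)).+1%:R / 2) / 2 = q%:R :> R.
    by field.
  exact: rpred_nat.
have /dvdnP[q ->] : ((2 * (b - a)).-1 %| lcm_upto (2 * n))%N.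
  by apply: dvdn_lcm_upto; lia.
have h0 : (2 * (b - a)).-1%:R != 0 :> R by rewrite pnatr_eq0; lia.
have h1 : 1 / 2 + a%:R - b%:R = - (2 * (b - a)).-1%:R / 2 :> R.
  have -> : (2 * (b - a)).-1%:R = 2 * (b%:R - a%:R) - 1 :> R.
    rewrite -natrB 1?ltnW// -natrM -[RHS](@natrB _ _ 1) ?subn1//; lia.
  by field.
rewrite h1 natrM.
have -> : q%:R * (2 * (b - a)).-1%:R / (- (2 * (b - a)).-1%:R / 2) / 2 = - q%:R :> R.
  by field.
by rewrite rpredN rpred_nat.
Qed.

Lemma half_add_neq0 (a b : nat) : 1 / 2 + a%:R - b%:R != 0 :> R.
Proof.
have := half_natr_neq0 R a b.
by have -> : a%:R - (b%:R - 1 / 2) = 1 / 2 + a%:R - b%:R :> R by ring.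
Qed.

(* Pascal-type recurrence: l! / (x)_(l+1) - l! / (x+1)_(l+1) = (l+1)! / (x)_(l+2) *)
Lemma lcm_upto_beta n (a b l : nat) : (b <= n)%N -> (a + l < n + b)%N ->
  (lcm_upto (2 * n))%:R *
    (l`!%:R / pochhammer (1 / 2 + a%:R - b%:R) l.+1) / 2 \is a (@Num.int R).
Proof.
move=> bn; elim: l a => [|l IHl] a alnb.
  rewrite addn0 in alnb.
  by rewrite pochhammerSl pochhammer0 mulr1 fact0 [1%:R / _]mul1r lcm_upto_half_inv.
set x := 1 / 2 + a%:R - b%:R.
have x1 : 1 / 2 + a.+1%:R - b%:R = x + 1 by rewrite /x -natr1; ring.
have nz i : x + i%:R != 0.
  have := half_add_neq0 (a + i) b; rewrite natrD.
  by have -> : 1 / 2 + (a%:R + i%:R) - b%:R = x + i%:R by rewrite /x; ring.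
have -> : l.+1`!%:R / pochhammer x l.+2 =
    l`!%:R / pochhammer x l.+1 - l`!%:R / pochhammer (x + 1) l.+1.
  rewrite [pochhammer x l.+2]pochhammerSl [pochhammer x l.+1]pochhammerSl.
  rewrite [pochhammer (x + 1) l.+1]pochhammerSr factS natrM -natr1.
  have Y0 : pochhammer (x + 1) l != 0.
    apply: pochhammer_neq0 => i _; have := nz i.+1; rewrite -natr1.
    by have -> : x + (i%:R + 1) = x + 1 + i%:R by ring.
  have := nz 0%N; rewrite addr0 => x0.
  have := nz l.+1; rewrite -natr1.
  have -> : x + (l%:R + 1) = x + 1 + l%:R by ring.
  by move=> xl0; field; rewrite x0 Y0 xl0.
rewrite mulrBr mulrBl rpredB//; first by apply: IHl; lia.
by rewrite -x1; apply: IHl; lia.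
Qed.

Lemma int_num_mu0 n l : (l <= n)%N ->
  (lcm_upto (2 * n))%:R ^+ 2 * mu0 R l \is a Num.int.
Proof.
elim: l => [|l IHl] ln; first by rewrite mulr0 rpred0.
rewrite /= mulrDr mulrN rpredD ?rpredN ?IHl 1?ltnW//.
set d := (lcm_upto _)%:R.
(* At s = -1/2 the two Pochhammer symbols share l!^2 and d^2 evenly, giving two factors for
   [lcm_upto_beta]; the 2 in front balances its halves against the 1/2 of the certificate. *)
have -> : d ^+ 2 * kappa0_cert l (- (1 / 2)) =
    2 * (d * (l`!%:R / pochhammer (1 / 2 + 0%:R - 0%:R) l.+1) / 2)
      * (d * (l`!%:R / pochhammer (1 / 2 + 0%:R - l.+1%:R) l.+1) / 2).
  rewrite /kappa0_cert opprK subr0 addr0.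
  have -> : - l.+1%:R + 1 / 2 = 1 / 2 - l.+1%:R :> R by ring.
  rewrite invfM; set A := (pochhammer _ _)^-1; set B := (pochhammer _ _)^-1.
  by field.
apply: rpredM; last by apply: (@lcm_upto_beta n 0 l.+1 l); lia.
apply: rpredM; first exact: (rpred_nat _ 2).
by apply: (@lcm_upto_beta n 0 0 l); lia.
Qed.

Lemma int_num_coef_cert n m l : (l <= n)%N -> (m < n)%N ->
  4 ^+ l * (lcm_upto (2 * n))%:R ^+ 2 *
    (catalan_coef R n l * kappa_cert m l (- (1 / 2))) \is a Num.int.
Proof.
move=> ln mn; set d := (lcm_upto _)%:R.
have -> : 4 ^+ l * d ^+ 2 * (catalan_coef R n l * kappa_cert m l (- (1 / 2))) =
   - (4 ^+ l * half_binom R n l) *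
    ('C(n, l)%:R * half_binom R (n - l) l * (l`!%:R / pochhammer (1 / 2) l)) * 2 *
    (d * (m`!%:R / pochhammer (1 / 2 + 0%:R - 0%:R) m.+1) / 2) *
    (d * (l`!%:R / pochhammer (1 / 2 + m%:R - l%:R) l.+1) / 2).
  rewrite /kappa_cert /catalan_coef opprK subr0 addr0.
  have -> : m%:R - l%:R + 1 / 2 = 1 / 2 + m%:R - l%:R :> R by ring.
  rewrite !invfM.
  set A := (pochhammer _ m.+1)^-1; set B := (pochhammer _ l)^-1.
  set C := (pochhammer _ l.+1)^-1.
  by field.
rewrite bin_half_binom//.
apply: rpredM; last by apply: (@lcm_upto_beta n m l l); lia.
apply: rpredM; last by apply: (@lcm_upto_beta n 0 0 m); lia.
apply: rpredM; last exact: (rpred_nat _ 2).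
by rewrite rpredM ?rpredN ?int_num_half_binom ?rpred_nat.
Qed.

Lemma int_num_coef_mu n l : (l <= n)%N ->
  2 ^+ (4 * n) * (lcm_upto (2 * n))%:R ^+ 2 *
    (catalan_coef R n l * mu R n l) \is a Num.int.
Proof.
move=> ln; set d := (lcm_upto _)%:R.
have n4 k : (4 : R) ^+ k \is a Num.int by rewrite rpredX//; exact: (rpred_nat _ 4).
(* Two powers 4^l clear both half-integer binomials of c_l in the [mu0] part; the certificate part
   needs only one of them. *)
have -> : 2 ^+ (4 * n) = 4 ^+ (n - l) * 4 ^+ (n - l) * (4 ^+ l * 4 ^+ l) :> R.
  rewrite -!exprD (_ : n - l + (n - l) + (l + l) = 2 * n)%N; last by lia.
  by rewrite (_ : 4 = 2 ^+ 2) -?exprM ?mulnA//; ring.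
rewrite /mu; set S := \sum_(m < n) _.
have -> : 4 ^+ (n - l) * 4 ^+ (n - l) * (4 ^+ l * 4 ^+ l) * d ^+ 2 *
    (catalan_coef R n l * (mu0 R l + S)) =
  4 ^+ (n - l) * 4 ^+ (n - l) *
  ('C(n, l)%:R * (4 ^+ l * half_binom R (n - l) l) * (4 ^+ l * half_binom R n l)
     * (d ^+ 2 * mu0 R l)
   + 4 ^+ l * (4 ^+ l * d ^+ 2 * (catalan_coef R n l * S))).
  by rewrite /catalan_coef; ring.
apply: rpredM; first exact: rpredM.
apply: rpredD.
  apply: rpredM; last exact: int_num_mu0.
  apply: rpredM; last exact: int_num_half_binom.
  by apply: rpredM; [exact: rpred_nat|exact: int_num_half_binom].
apply: rpredM => //; rewrite /S !mulr_sumr rpred_sum// => m _.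
exact: int_num_coef_cert.
Qed.

End Integrality.

(** * Expansion of the kernel *)

Section Kernel.
Variable R : realType.
Implicit Types (e s : R).

Lemma gbinomE (x : R) m : gbinom x m = pochhammer (x - m%:R + 1) m / m`!%:R.
Proof.
rewrite /gbinom; congr (_ / _); elim: m => [|m IHm].
  by rewrite big_ord0 pochhammer0.
rewrite big_ord_recr /= IHm pochhammerSl mulrC; congr (_ * _).
  by rewrite -natr1; ring.
by congr pochhammer; rewrite -natr1; ring.
Qed.

(** At s = j - e the product (-s)_(n+1) splits into (-1)^j (1 - e)_j, the vanishing factor e, and (1
    + e)_(n-j); cubing it accounts for the sign and e^3. *)
Lemma b_kernelE n j e : (j <= n)%N -> 0 < e < 1 / 2 ->
  b_kernel n j e = (-1) ^+ j * (e ^+ 3 * catalan_rat n (j%:R - e)).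
Proof.
move=> jn e01; set s := j%:R - e.
have hs : noninteger s by have := noninteger_eps j 0 e01; rewrite subr0.
have e0 : e != 0 by rewrite gt_eqF//; case/andP: e01.
have Q0 : pochhammer (- s) n.+1 != 0.
  by have := noninteger_pochhammer 0 0 n.+1 hs; rewrite subrr sub0r.
set P := pochhammer (1 - e) j * pochhammer (1 + e) (n - j).
have QE : pochhammer (- s) n.+1 = (-1) ^+ j * e * P.
  have -> : n.+1 = (j + (n - j).+1)%N by rewrite addnS subnKC.
  rewrite pochhammerD pochhammer_oppr.
  have -> : 1 - - s - j%:R = 1 - e by rewrite /s; ring.
  have -> : - s + j%:R = e by rewrite /s; ring.
  by rewrite pochhammerSl [e + 1]addrC /P; ring.
have P0 : P != 0 by move: Q0; rewrite QE mulf_eq0 negb_or => /andP[].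
have f0 := fact_neq0 R n.
rewrite /b_kernel /catalan_rat -/P !gbinomE QE.
have -> : n%:R + j%:R - e - 1 / 2 - n%:R + 1 = s + 1 / 2 by rewrite /s; field.
have -> : 2 * n%:R - j%:R + e - 1 / 2 - n%:R + 1 = n%:R + 1 / 2 - s.
  by rewrite /s; field.
have -> : n%:R / 2 - j%:R + e = n%:R / 2 - s by rewrite /s; ring.
have sg0 : (-1) ^+ j != 0 :> R by rewrite signr_eq0.
have -> : ((-1) ^+ j * e * P) ^+ 3 = (-1) ^+ j * (e * P) ^+ 3.
  by rewrite -mulrA exprMn -exprM mulnC exprM (_ : (-1) ^+ 3 = -1)//; ring.
by field; rewrite P0 f0 e0 sg0.
Qed.

Lemma alt_sum_right N j e : alt_sum N (N + j) e =
  (-1) ^+ j * \sum_(1 <= k < j.+1) (-1) ^+ k / (k%:R - 1 / 2 - e).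
Proof.
rewrite /alt_sum big_split_ord /= [_ + _ - _]addrAC subrr add0r big_add1 big_mkord /=.
rewrite exprD -mulrA mulrCA mulr_sumr; congr (_ * _); apply: eq_bigr => k _.
rewrite mulrA -addnS exprD mulrA -expr2 sqrr_sign.
congr (_ / _); first by rewrite mul1r.
by rewrite natrD -[k.+1%:R]natr1; field.
Qed.

Lemma regular0_pochhammer (f : R -> R) k :
  regular0 f -> regular0 (fun e => pochhammer (f e) k).
Proof.
move=> rf; apply: regular0_prod => i.
by apply: regular0D => //; exact: regular0_cst.
Qed.

Lemma regular0_catalan_rat n (x : R) : pochhammer (- x) n.+1 != 0 ->
  regular0 (fun e => catalan_rat n (x - e)).
Proof.
move=> x0.
have rx : regular0 (fun e => x - e).
  by apply: regular0B; [exact: regular0_cst|exact: regular0_id].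
apply: regular0M.
  apply: regular0M.
    apply: regular0M; first exact: regular0_cst.
    by apply: regular0B => //; exact: regular0_cst.
  apply: regular0M; apply: regular0_pochhammer.
    by apply: regular0D => //; exact: regular0_cst.
  by apply: regular0B => //; exact: regular0_cst.
apply: regular0V; first by rewrite subr0 expf_neq0.
by apply: regular0X; apply: regular0_pochhammer; exact: regular0N.
Qed.

Lemma regular0_b_kernel n j : (j <= n)%N -> regular0 (@b_kernel R n j).
Proof.
move=> jn; have rc c : regular0 (fun _ : R => c) by exact: regular0_cst.
have ri := regular0_id R.
have rg (f : R -> R) m : regular0 f -> regular0 (fun e => gbinom (f e) m).
  move=> rf; apply: regular0M => //; apply: regular0_prod => i.
  exact: regular0B.
apply: regular0M; last first.
  apply: rg; apply: regular0B => //; apply: regular0D => //.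
apply: regular0M; last first.
  by apply: rg; apply: regular0B => //; apply: regular0B.
apply: regular0M; first exact: regular0D.
apply: regular0X; apply: regular0M => //; apply: regular0V.
  rewrite subr0 addr0 mulf_neq0//; apply: pochhammer_neq0 => i _;
    by rewrite addrC natr1 pnatr_eq0.
apply: regular0M; apply: regular0_pochhammer; [exact: regular0B|exact: regular0D].
Qed.

(** From 1 / (x - e) = 1/x + e/x^2 + e^2/x^3 + ... the Taylor coefficients are the three inner sums
    in the definition of b_n. *)
Lemma jet2_harmonic j : jet2
  (fun e : R => \sum_(1 <= k < j.+1) (-1) ^+ k / (k%:R - 1 / 2 - e))
  (\sum_(1 <= k < j.+1) (-1) ^+ k / (k%:R - 1 / 2) ^+ 1)
  (\sum_(1 <= k < j.+1) (-1) ^+ k / (k%:R - 1 / 2) ^+ 2)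
  (\sum_(1 <= k < j.+1) (-1) ^+ k / (k%:R - 1 / 2) ^+ 3).
Proof.
rewrite (_ : (fun e => _) = (fun e : R =>
    \sum_(1 <= k < j.+1) (-1) ^+ k / (k%:R - 1 / 2 + -1 * e))); last first.
  by apply/funext => e; apply: eq_bigr => k _; rewrite mulN1r.
elim: (index_iota _ _) => [|k r IHr].
  rewrite !big_nil (_ : (fun e => _) = fun=> 0); first exact: jet2_cst.
  by apply/funext => e; rewrite big_nil.
rewrite !big_cons (_ : (fun e => _) = (fun e : R => (-1) ^+ k / (k%:R - 1 / 2 + -1 * e) +
  \sum_(k <- r) (-1) ^+ k / (k%:R - 1 / 2 + -1 * e))); last first.
  by apply/funext => e; rewrite big_cons.
apply: jet2D => //.
have k0 : k%:R - 1 / 2 != 0 :> R.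
  by have := half_natr_neq0 R 0 k; rewrite sub0r oppr_eq0.
move: (k%:R - 1 / 2 : R) k0 => x x0.
have := jet2D (jet2_cst x) (jet2M (jet2_cst (-1)) (jet2_id R)).
rewrite !(mul0r, mulr0, mulr1, mul1r, add0r, addr0) => jx.
have := jet2M (jet2_cst ((-1) ^+ k)) (jet2V x0 jx).
by rewrite opprK sqrrN expr1n !(mul0r, addr0) subr0 mul1r expr1 mul1r.
Qed.

(** Leibniz' rule: derivatives of order 3 - e over (3 - e)! are Taylor coefficients of [f], so the
    sum over e is a Cauchy product. *)
Lemma coef2_mul_derive (f h : R -> R) (S : nat -> R) :
  regular0 f -> jet2 h (S 1%N) (S 2%N) (S 3%N) ->
  coef2 (fun e => f e * h e)
    (\sum_(1 <= e < 4) (1 / (3 - e)`!%:R * derive1n (3 - e) f 0 * S e)).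
Proof.
move=> [a [b [c jf]]] jh; have [Ka Kb Kc] := jet2_derive jf.
have B (F : nat -> R) : \sum_(1 <= e < 4) F e = F 1%N + (F 2%N + F 3%N).
  by rewrite 3?big_ltn// big_geq// addr0.
rewrite {}B !subSS !subn0 Ka Kb Kc.
have -> : 1 / 2`!%:R * (2 * c) * S 1%N +
    (1 / 1`!%:R * b * S 2%N + 1 / 0`!%:R * a * S 3%N) =
  a * S 3%N + b * S 2%N + c * S 1%N.
  by rewrite !factS fact0; field.
exact: coef2_jet (jet2M jf jh).
Qed.

Lemma coef2_catalan_b n : coef2
  (fun e => \sum_(j < n.+1) b_kernel n j e *
     \sum_(1 <= k < j.+1) (-1) ^+ k / (k%:R - 1 / 2 - e))
  ((-1) ^+ n * catalan_b R n).
Proof.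
rewrite /catalan_b signrMK.
suff h (j : 'I_n.+1) : coef2 (fun e : R => b_kernel n j e *
     \sum_(1 <= k < j.+1) (-1) ^+ k / (k%:R - 1 / 2 - e))
   (\sum_(1 <= e < 4) (1 / (3 - e)`!%:R * derive1n (3 - e) (@b_kernel R n j) 0
     * \sum_(1 <= k < j.+1) (-1) ^+ k / (k%:R - 1 / 2) ^+ e)).
  exact: coef2_sum _ h.
have jn : (j <= n)%N by rewrite -ltnS.
exact: (@coef2_mul_derive _ _
  (fun q => \sum_(1 <= k < j.+1) (-1) ^+ k / (k%:R - 1 / 2) ^+ q)
  (regular0_b_kernel jn) (jet2_harmonic j)).
Qed.

(** One coefficient of e^2 is computed twice, from the definition of b_n and from the expansion of
    Rt into the kappa_(n,l); [coef2_unique] equates the results. *)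
Lemma catalan_b_mu n : catalan_b R n =
  \sum_(k < n.+1) (-1) ^+ (n + k) * (catalan_coef R n (n - k) * mu R n (n - k)).
Proof.
have c1 := coef2_catalan_b n.
have c2 : coef2 (alt_functional n (n + n.+1).+1 (@catalan_rat R n))
    (\sum_(k < n.+1) (-1) ^+ k * catalan_coef R n (n - k) * mu R n (n - k)).
  have h (k : 'I_n.+1) : coef2 (fun e : R => (-1) ^+ k * catalan_coef R n (n - k) *
      alt_functional n (n + n.+1).+1 (@kappa R n (n - k)) e)
     ((-1) ^+ k * catalan_coef R n (n - k) * mu R n (n - k)).
    by apply: coef2Z; apply: coef2_kappa; lia.
  have := coef2_sum (index_enum 'I_n.+1) h; apply: eq_coef2 => e e01.
  under eq_bigr do rewrite -alt_functionalZ.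
  rewrite -alt_functional_sum /alt_functional; congr (_ * _).
  apply: eq_bigr => i _; congr (_ * _); rewrite catalan_ratE//.
  exact: noninteger_eps.
pose F (i : nat) e := catalan_rat n (i%:R - n%:R - e) * alt_sum n i e.
(* The poles of Rt are s = 0, ..., n, so the indices below n and the extra last index 2n + 1
   contribute nothing. *)
have regF i : ~~ (n <= i <= n + n)%N -> regular0 (F i).
  move=> ni; apply: regular0M; last exact: regular0_alt_sum.
  apply: regular0_catalan_rat; apply: pochhammer_neq0 => k kn.
  rewrite opprB addrAC subr_eq0 -natrD eqr_nat.
  by apply: contra ni => /eqP <-; lia.
have reg : regular0 (fun e => \sum_(i < n) F i e + F (n + n.+1)%N e).
  apply: regular0D; last by apply: regF; lia.
  by apply: regular0_sum => i _; apply: regF; have := ltn_ord i; lia.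
have E : (-1) ^+ n * catalan_b R n =
    \sum_(k < n.+1) (-1) ^+ k * catalan_coef R n (n - k) * mu R n (n - k).
  apply: (coef2_unique _ c2).
  have := coef2D c1 (coef2_regular reg); rewrite addr0; apply: eq_coef2 => e e01.
  rewrite /alt_functional [X in _ = _ * X]big_ord_recr [X in _ = _ * (X + _)]big_split_ord /=.
  have -> : \sum_(j < n.+1) b_kernel n j e *
      \sum_(1 <= k < j.+1) (-1) ^+ k / (k%:R - 1 / 2 - e) =
      e ^+ 3 * \sum_(j < n.+1) F (n + j)%N e.
    rewrite mulr_sumr; apply: eq_bigr => j _.
    have jn : (j <= n)%N by rewrite -ltnS.
    rewrite b_kernelE// /F alt_sum_right.
    have -> : (n + j)%:R - n%:R = j%:R :> R by rewrite natrD; ring.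
    by ring.
  by rewrite /F; ring.
rewrite -[LHS](signrMK n) E mulr_sumr.
by apply: eq_bigr => k _; rewrite exprD !mulrA.
Qed.

End Kernel.

Theorem theorem2 (R : realType) (n : nat) (n_gt0 : (0 < n)%N) :
  2 ^+ (4 * n) * (lcm_upto (2 * n))%:R ^+ 2 * catalan_b R n \is a Num.int.
Proof.
rewrite catalan_b_mu mulr_sumr rpred_sum// => k _.
by rewrite mulrCA rpredM ?rpredX ?rpredN ?rpred1// int_num_coef_mu// leq_subr.
Qed.
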